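(* Let $X=\{X(t)\}_{t\in[0,1]}$ be an $E$-valued infinitely divisible process without Gaussian part, with trajectories in $D([0,1];E)$, whose finite dimensional distributions are specified by a function $b:[0,1]\to E$ and L\'evy measures $\nu_{t_1,\ldots,t_n}$ on $E^n$ through $$\mathbb E\exp\Bigl\{i\sum_{j=1}^n\langle x_j^*,X(t_j)\rangle\Bigr\}=\exp\Bigl\{i\sum_{j=1}^n\langle x_j^*,b(t_j)\rangle+\int_{E^n}\Bigl(e^{i\sum_{j=1}^n\langle x_j^*,x_j\rangle}-1-i\sum_{j=1}^n\langle x_j^*,[\![x_j]\!]\rangle\Bigr)\nu_{t_1,\ldots,t_n}(dx_1\cdots dx_n)\Bigr\}$$ for all $t_1,\ldots,t_n\in[0,1]$, $x_1^*,\ldots,x_n^*\in E^*$. Let $H:[0,1]\times\mathbb R_+\times\mathcal V\to E$ be a measurable function such that for every $t_1,\ldots,t_n\in[0,1]$ and $B\in\mathcal B(E^n)$ $$\int_0^\infty\mathbb P\bigl((H(t_1,r,V),\ldots,H(t_n,r,V))\in B\setminus\{0\}\bigr)\,dr=\nu_{t_1,\ldots,t_n}(B),$$ $H(\cdot,r,v)\in D([0,1];E)$ for every $(r,v)\in\mathbb R_+\times\mathcal V$, and $r\mapsto\|H(\cdot,r,v)\|$ is nonincreasing for every $v\in\mathcal V$. Let, for $u>0$, $$A^u(t)=\int_0^u\mathbb E[\![H(t,r,V)]\!]\,dr,\qquad Y^u(t)=b(t)+\sum_{j:\Gamma_j\le u}H(t,\Gamma_j,V_j)-A^u(t),$$ and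 let $Y=\{Y(t)\}_{t\in[0,1]}$ be the process with paths in $D([0,1];E)$ which is the a.s. uniform limit on $[0,1]$ of $Y^u$ as $u\to\infty$. Then, with probability $1$, $$Y(t)=b(t)+\sum_{j=1}^\infty\bigl[H(t,\Gamma_j,V_j)-C_j(t)\bigr]\qquad\text{for all }t\in[0,1],$$ where the series converges a.s. uniformly on $[0,1]$ and $C_j(t)=A^{\Gamma_j}(t)-A^{\Gamma_{j-1}}(t)$. Moreover, if $b$ and $A^u$, for sufficiently large $u$, are continuous functions of $t\in[0,1]$, then with probability $1$ $$\Delta Y(t)=\sum_{j=1}^\infty\Delta H(t,\Gamma_j,V_j)\qquad\text{for all }t\in[0,1],$$ where the series converges a.s. uniformly on $[0,1]$.
   Context: $E$ is a separable Banach space with norm $|\cdot|_E$ and dual $E^*$; $\langle x^*,x\rangle=x^*(x)$. $D([0,1];E)$ is the space of c\`adl\`ag functions from $[0,1]$ into $E$, with the cylindrical $\sigma$-algebra generated by evaluations, and $\|x\|=\sup_{t\in[0,1]}|x(t)|_E$. $\Delta x(t)=x(t)-x(t-)$ denotes the jump of $x\in D([0,1];E)$ at $t$ (with $\Delta x(0)=0$), and $\Delta H(t,r,v)$ is the jump at $t$ of $H(\cdot,r,v)$. The truncation function is $[\![x]\!]=x/(1\vee|x|_E)$, $x\in E$. An $E$-valued process is infinitely divisible if all vectors $(X(t_1),\ldots,X(t_n))$ have infinitely divisible distributions in $E^n$. A L\'evy measure is the $\sigma$-finite measure (with no mass at $0$) appearing in the L\'evy--Khintchine representation of an infinitely divisible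 distribution. $\{V_j\}_{j\ge1}$ is an i.i.d. sequence of random elements in a measurable space $\mathcal V$ with common distribution $\eta$, and $V=V_1$. $\{\Gamma_j\}_{j\ge1}$ is a sequence of partial sums of i.i.d. standard exponential random variables, independent of $\{V_j\}$; $\Gamma_0=0$ and $A^0=0$. Integrals of $E$-valued functions are Bochner integrals. The a.s. uniform limit $Y$ of $Y^u$ exists under these assumptions and has the same finite dimensional distributions as $X$. *)

(* Defs.v *)
From HB Require Import structures.
From mathcomp Require Import all_boot all_order all_algebra.
From mathcomp Require Import finmap complex.
From mathcomp Require Import all_classical all_reals all_analysis.

Set Implicit Arguments.
Unset Strict Implicit.
Unset Printing Implicit Defensive.

Import Order.TTheory GRing.Theory Num.Theory.
Import numFieldNormedType.Exports.

Local Open Scope classical_set_scope.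
Local Open Scope complex_scope.
Local Open Scope ring_scope.

(* Functions on [0,1] (resp. R_+) are encoded as total functions on R that are
   only constrained on [0,1] (resp. [0,+oo[). *)

Notation borel T := (g_sigma_algebraType [set U : set T | open U]).

Definition separable (T : topologicalType) : Prop :=
  exists S : set T, countable S /\ dense S.

Definition trunc (R : realType) (E : normedModType R) (x : E) : E :=
  (Num.max 1 `|x|)^-1 *: x.

(* At t = 1 no right limit is required. *)
Definition cadlag (R : realType) (E : normedModType R) (x : R -> E) : Prop :=
  (forall t : R, 0 <= t < 1 -> x s @[s --> t^'+] --> x t) /\
  (forall t : R, 0 < t <= 1 -> cvg (x s @[s --> t^'-])).

Definition jump (R : realType) (E : normedModType R) (x : R -> E) (t : R) : E :=
  if 0 < t then x t - lim (x s @[s --> t^'-]) else 0.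

Definition sup_norm (R : realType) (E : normedModType R) (x : R -> E) : R :=
  sup [set `|x t| | t in `[0, 1]].

Definition integrable_simple (R : realType) (E : normedModType R)
    d (T : measurableType d) (mu : {measure set T -> \bar R}) (D : set T)
    (s : T -> E) : Prop :=
  [/\ measurable_fun setT (s : T -> borel E), finite_set (range s) &
      forall y : E, y != 0 -> (mu (D `&` s @^-1` [set y]) < +oo)%E].

Definition simple_integral (R : realType) (E : normedModType R)
    d (T : measurableType d) (mu : {measure set T -> \bar R}) (D : set T)
    (s : T -> E) : E :=
  \sum_(y \in range s) fine (mu (D `&` s @^-1` [set y])) *: y.

Definition is_bochner_integral (R : realType) (E : normedModType R)
    d (T : measurableType d) (mu : {measure set T -> \bar R}) (D : set T)
    (f : T -> E) (I : E) : Prop :=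
  exists s : nat -> T -> E,
  [/\ forall n, integrable_simple mu D (s n),
      {ae mu, forall x, D x -> s n x @[n --> \oo] --> f x},
      (\int[mu]_(x in D) `|f x - s n x|%:E)%E @[n --> \oo] --> 0%E &
      simple_integral mu D (s n) @[n --> \oo] --> I].

(* Equal to 0 when f is not Bochner integrable on D. *)
Definition bochner_integral (R : realType) (E : normedModType R)
    d (T : measurableType d) (mu : {measure set T -> \bar R}) (D : set T)
    (f : T -> E) : E :=
  xget 0 [set I | is_bochner_integral mu D f I].

Definition cexp (R : realType) (z : R[i]) : R[i] :=
  (expR (complex.Re z))%:C * (cos (complex.Im z) +i* sin (complex.Im z)).

Definition cintegral (R : realType) d (T : measurableType d)
    (mu : {measure set T -> \bar R}) (f : T -> R[i]) : R[i] :=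
  Rintegral mu setT (fun x => complex.Re (f x))
  +i* Rintegral mu setT (fun x => complex.Im (f x)).

Definition cintegrable (R : realType) d (T : measurableType d)
    (mu : {measure set T -> \bar R}) (f : T -> R[i]) : Prop :=
  mu.-integrable setT (fun x => (complex.Re (f x))%:E) /\
  mu.-integrable setT (fun x => (complex.Im (f x))%:E).

(* E^n is 'rV[E]_n with the product topology, and its dual is (E^* )^n. *)
Definition pairing (R : realType) (E : normedModType R) (n : nat)
    (xs : 'I_n -> {linear E -> R^o}) (x : 'rV[E]_n) : R :=
  \sum_(j < n) xs j (x 0 j).

Definition char_fun (R : realType) (E : normedModType R) (n : nat)
    (mu : probability (borel 'rV[E]_n) R)
    (xs : 'I_n -> {linear E -> R^o}) : R[i] :=
  cintegral mu (fun x => cexp (0 +i* pairing xs x)).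

Definition lk_integrand (R : realType) (E : normedModType R) (n : nat)
    (xs : 'I_n -> {linear E -> R^o}) (x : 'rV[E]_n) : R[i] :=
  cexp (0 +i* pairing xs x) - 1 - (0 +i* pairing xs (map_mx (@trunc R E) x)).

(* rho^{*(k+1)}(A) = \int rho^{*k}(A - y) rho(dy) *)
Fixpoint conv_pow (R : realType) (E : normedModType R) (n : nat)
    (rho : probability (borel 'rV[E]_n) R) (k : nat) (A : set 'rV[E]_n) :
    \bar R :=
  if k is k'.+1 then
    (\int[rho]_y conv_pow rho k' [set x | A (x + (y : 'rV[E]_n))%R])%E
  else \d_((0 : 'rV[E]_n) : borel 'rV[E]_n) A.

Definition infinitely_divisible (R : realType) (E : normedModType R) (n : nat)
    (mu : set 'rV[E]_n -> \bar R) : Prop :=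
  forall k : nat, exists rho : probability (borel 'rV[E]_n) R,
  forall A : set (borel 'rV[E]_n), measurable A -> mu A = conv_pow rho k.+1 A.

Definition covariance_form (R : realType) (E : normedModType R) (n : nat)
    (gam : probability (borel 'rV[E]_n) R)
    (xs : 'I_n -> {linear E -> R^o}) : R :=
  Rintegral gam setT (fun x => pairing xs x ^+ 2).

Definition centered_gaussian (R : realType) (E : normedModType R) (n : nat)
    (gam : probability (borel 'rV[E]_n) R) : Prop :=
  forall xs : 'I_n -> {linear E -> R^o}, (forall j, continuous (xs j)) ->
  gam.-integrable setT (fun x => (pairing xs x ^+ 2)%:E) /\
  char_fun gam xs = cexp ((- (2^-1 * covariance_form gam xs)) +i* 0).

(* The Gaussian part is given by a centered Gaussian law gam, through its
   covariance; the truncation acts on each coordinate of E^n. *)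
Definition levy_khintchine (R : realType) (E : normedModType R) (n : nat)
    (mu : probability (borel 'rV[E]_n) R) (b : 'rV[E]_n)
    (gam : probability (borel 'rV[E]_n) R)
    (nu : {measure set (borel 'rV[E]_n) -> \bar R}) : Prop :=
  forall xs : 'I_n -> {linear E -> R^o}, (forall j, continuous (xs j)) ->
  cintegrable nu (lk_integrand xs) /\
  char_fun mu xs =
    cexp ((- (2^-1 * covariance_form gam xs)) +i* pairing xs b
          + cintegral nu (lk_integrand xs)).

Definition levy_measure (R : realType) (E : normedModType R) (n : nat)
    (nu : {measure set (borel 'rV[E]_n) -> \bar R}) : Prop :=
  [/\ sigma_finite setT nu, nu [set 0 : 'rV[E]_n] = 0%E &
      exists (mu gam : probability (borel 'rV[E]_n) R) (b : 'rV[E]_n),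
      [/\ infinitely_divisible mu, centered_gaussian gam &
          levy_khintchine mu b gam nu]].

(* Processes are written X t w, with time t and outcome w. *)
Definition process (R : realType) (E : normedModType R)
    d (W : measurableType d) (X : R -> W -> E) : Prop :=
  forall t, t \in `[0, 1] -> measurable_fun setT (X t : W -> borel E).

Definition fdd (R : realType) (E : normedModType R)
    d (W : measurableType d) (P : probability W R) (X : R -> W -> E)
    (n : nat) (t : 'I_n -> R) : set 'rV[E]_n -> \bar R :=
  fun B => P [set w | B (\row_j X (t j) w)].

Definition infinitely_divisible_process (R : realType) (E : normedModType R)
    d (W : measurableType d) (P : probability W R) (X : R -> W -> E) : Prop :=
  forall (n : nat) (t : 'I_n -> R), (forall j, t j \in `[0, 1]) ->
  infinitely_divisible (fdd P X t).

Definition mutually_independent (R : realType) d (W : measurableType d)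
    d' (T : measurableType d') (P : probability W R) (X : nat -> W -> T) :
    Prop :=
  forall (J : {fset nat}) (B : nat -> set T), (forall i, measurable (B i)) ->
  P (\bigcap_(i in [set` J]) (X i @^-1` B i)) =
  (\prod_(i <- J) P (X i @^-1` B i))%E.

Definition generated_sigma_algebra d (W : measurableType d)
    d' (T : measurableType d') (X : nat -> W -> T) : set (set W) :=
  <<s [set A | exists i (B : set T), measurable B /\ A = X i @^-1` B] >>.

Definition independent_sequences (R : realType) d (W : measurableType d)
    d1 (T1 : measurableType d1) d2 (T2 : measurableType d2)
    (P : probability W R) (X1 : nat -> W -> T1) (X2 : nat -> W -> T2) : Prop :=
  forall A B, generated_sigma_algebra X1 A -> generated_sigma_algebra X2 B ->
  P (A `&` B) = (P A * P B)%E.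

(* Gamma_0 = 0, and Gamma_j is the sum of the first j terms of e. *)
Definition partial_sum (R : realType) (W : Type) (e : nat -> W -> R)
    (j : nat) (w : W) : R :=
  \sum_(i < j) e i w.

(* A^u(t); it vanishes for u <= 0. *)
Definition compensator (R : realType) (E : normedModType R)
    d (W : measurableType d) (P : probability W R) (S : Type)
    (H : R -> R -> S -> E) (V : W -> S) (u t : R) : E :=
  bochner_integral lebesgue_measure `[0, u] (fun r =>
    bochner_integral P setT (fun w => trunc (H t r (V w)))).

(* V is indexed from 0 (the mathematical V_1 is V 0), whereas Gamma_0 = 0: the
   j-th mathematical term, j >= 1, uses Gamma j and V j.-1. The sum over
   {j : Gamma_j <= u} is finite almost surely. *)
Definition truncated_series (R : realType) (E : normedModType R)
    d (W : measurableType d) (P : probability W R) (S : Type)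
    (b : R -> E) (H : R -> R -> S -> E) (Gamma : nat -> W -> R)
    (V : nat -> W -> S) (u t : R) (w : W) : E :=
  b t
  + \sum_(j \in [set j : nat | Gamma j.+1 w <= u]) H t (Gamma j.+1 w) (V j w)
  - compensator P H (V 0) u t.

(* The mathematical C_{j+1}(t). *)
Definition centering (R : realType) (E : normedModType R)
    d (W : measurableType d) (P : probability W R) (S : Type)
    (H : R -> R -> S -> E) (Gamma : nat -> W -> R)
    (V : nat -> W -> S) (j : nat) (t : R) (w : W) : E :=
  compensator P H (V 0) (Gamma j.+1 w) t - compensator P H (V 0) (Gamma j w) t.

Definition series_sum (R : realType) (E : normedModType R)
    (f : nat -> R -> E) (t : R) : E :=
  limn (series (f ^~ t)).

Definition uniformly_convergent_series (R : realType) (E : normedModType R)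
    (f : nat -> R -> E) : Prop :=
  {uniform `[0, 1], (fun n t => series (f ^~ t) n) @ \oo --> series_sum f}.

(* Main.v *)
(** Almost surely every interarrival time is positive and infinitely many of them
    exceed 1, so Gamma is strictly increasing and tends to infinity. Hence Y^u
    can be sampled along u = Gamma_n; since A^0 = 0, the centerings telescope
    and Y^{Gamma_n} - b is exactly the n-th partial sum of the series.
    The jump map is linear and at most doubles the uniform norm on [0,1], so it
    passes to the uniform limit; when b and A^{Gamma_n} are continuous, the jump
    of Y^{Gamma_n} is the n-th partial sum of the jumps of H. *)
Require Import Defs.
From HB Require Import structures.
From mathcomp Require Import all_boot all_order all_algebra.
From mathcomp Require Import finmap complex.
From mathcomp Require Import all_classical all_reals all_analysis.

Set Implicit Arguments.
Unset Strict Implicit.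
Unset Printing Implicit Defensive.

Import Order.TTheory GRing.Theory Num.Theory.
Import numFieldNormedType.Exports.

Local Open Scope classical_set_scope.
Local Open Scope complex_scope.
Local Open Scope ring_scope.

(** * Uniform convergence and the sum of a series of functions *)

Lemma uniform_cvgP (R : realType) (E : normedModType R) (U : choiceType)
    (I : Type) (G : set_system I) (A : set U) (F : I -> U -> E) (f : U -> E) :
  Filter G ->
  {uniform A, F i @[i --> G] --> f} <->
  forall eps : R, 0 < eps ->
    \forall i \near G, forall t, A t -> `|f t - F i t| < eps.
Proof.
move=> FG; split=> [cF eps eps0|cF].
  have := cF [set h | forall t, A t -> `|f t - h t| < eps]; apply.
  apply/uniform_nbhs; exists [set xy | ball xy.1 eps xy.2]; split.
    by rewrite -entourage_ballE; exists eps.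
  by move=> h /= fh t At; have := fh t At; rewrite -ball_normE.
move=> Q /uniform_nbhs[B [+ BQ]].
rewrite -entourage_ballE => -[eps /= eps0 epsB].
apply: filterS (cF eps eps0) => i fFi; apply: BQ => /= t At.
by apply: epsB => /=; rewrite -ball_normE; exact: fFi.
Qed.

(** A uniform limit is also a pointwise limit on $[0,1]$, which determines [series_sum] there. It
    thus suffices to exhibit some uniform limit of the partial sums; both halves of the theorem end
    this way. *)
Lemma uniformly_convergent_seriesP (R : realType) (E : normedModType R)
    (f : nat -> R -> E) (g : R -> E) :
  {uniform `[0, 1], (fun n t => series (f ^~ t) n) @ \oo --> g} ->
  uniformly_convergent_series f /\
  forall t, t \in `[0, 1] -> g t = series_sum f t.
Proof.
move=> /uniform_cvgP cf.
have gE t : t \in `[0, 1] -> g t = series_sum f t.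
  move=> t01; apply/esym; apply: cvg_lim => //; apply/cvgrPdist_lt => eps eps0.
  by apply: filterS (cf eps eps0) => n; apply; exact: t01.
split=> //; apply/uniform_cvgP => eps eps0.
apply: filterS (cf eps eps0) => n fn t t01.
by rewrite -gE//; exact: fn.
Qed.

(** * Jumps and left limits *)

Lemma jump_cvg (R : realType) (E : normedModType R) (x : R -> E) (t : R)
    (l : E) :
  0 < t -> x s @[s --> t^'-] --> l -> jump x t = x t - l.
Proof. by move=> t0 xl; rewrite /jump t0 (cvg_lim _ xl). Qed.

Lemma jump_le (R : realType) (E : normedModType R) (x : R -> E) (c t : R) :
  0 <= c -> t \in `[0, 1] -> (0 < t -> cvg (x s @[s --> t^'-])) ->
  (forall s, s \in `[0, 1] -> `|x s| <= c) -> `|jump x t| <= c + c.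
Proof.
move=> c0 t01 xl xc; rewrite /jump; case: ifPn => [t0|_]; last first.
  by rewrite normr0 addr_ge0.
have {}xl := xl t0; apply: (le_trans (ler_normB _ _)); apply: lerD; first exact: xc.
(* The norm of the left limit is the limit of the norms, and points just to the left of $t>0$ still
   lie in $[0,1]$, where [c] is a bound. *)
rewrite -lim_norm//.
apply: limr_le; first exact: is_cvg_norm.
near=> s; apply: xc; rewrite in_itv/=; apply/andP; split.
  by near: s; exact: nbhs_left_ge.
apply: (@le_trans _ _ t); last by move: t01; rewrite in_itv/= => /andP[].
by near: s; exact: nbhs_left_le.
Unshelve. all: by end_near. Qed.

Lemma jumpB (R : realType) (E : normedModType R) (x y : R -> E) (t : R) :
  (0 < t -> cvg (x s @[s --> t^'-])) -> (0 < t -> cvg (y s @[s --> t^'-])) ->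
  jump (fun s => x s - y s) t = jump x t - jump y t.
Proof.
move=> xl yl; have [t0|t0] := ltP 0 t; last first.
  by rewrite /jump ltNge t0/= subr0.
rewrite (jump_cvg t0 (cvgB (xl t0) (yl t0))) (jump_cvg t0 (xl t0)).
by rewrite (jump_cvg t0 (yl t0)) !opprD addrACA.
Qed.

Lemma within_continuous_left (R : realType) (E : normedModType R)
    (x : R -> E) (t : R) :
  {within `[0, 1], continuous x} -> 0 < t <= 1 -> x s @[s --> t^'-] --> x t.
Proof.
move=> /(continuous_within_itvP _ ltr01)[x01 _ x1] /andP[t0].
(* At $t=1$ continuity within $[0,1]$ is already left continuity; at an interior point the two-sided
   limit is restricted. *)
rewrite le_eqVlt => /orP[/eqP->//|t1].
by apply: cvg_at_left_filter; apply: x01; rewrite in_itv/= t0.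
Qed.

(** * Bochner integrals over null sets, and $A^0=0$ *)

Lemma bochner_integral_null (R : realType) (E : normedModType R)
    d (T : measurableType d) (mu : {measure set T -> \bar R}) (D : set T)
    (f : T -> E) :
  measurable D -> mu D = 0%E -> bochner_integral mu D f = 0.
Proof.
(* Without a Bochner integral [xget] returns its default 0. Otherwise all approximating simple
   integrals over [D] vanish, hence so does their limit. *)
move=> mD D0; rewrite /bochner_integral; case: xgetP => // I _ [s [sD _ _ sI]].
have s0 n : simple_integral mu D (s n) = 0.
  rewrite /simple_integral; apply: fsbig1 => y _.
  have [ms _ _] := sD n.
  (* Singletons are Borel because a normed space is Hausdorff. *)
  have mDy : measurable (D `&` s n @^-1` [set y]).
    apply: measurableI => //; rewrite -[X in measurable X]setTI.
    apply: ms => //; rewrite -[X in measurable X]setCK.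
    apply: measurableC; apply: sub_sigma_algebra; rewrite /= openC.
    exact/accessible_closed_set1/hausdorff_accessible/norm_hausdorff.
  suff -> : mu (D `&` s n @^-1` [set y]) = 0%E by rewrite /= scale0r.
  apply/eqP; rewrite eq_le measure_ge0 andbT -D0.
  by apply: le_measure; rewrite ?inE//; exact: subIsetl.
rewrite -(cvg_lim _ sI)//; apply: cvg_lim => //.
by under eq_fun do rewrite s0; exact: cvg_cst.
Qed.

Lemma compensator0 (R : realType) (E : normedModType R)
    d (W : measurableType d) (P : probability W R) (S : Type)
    (H : R -> R -> S -> E) (V : W -> S) (t : R) :
  compensator P H V 0 t = 0.
Proof.
apply: bochner_integral_null; first exact: measurable_itv.
by rewrite set_itv1; exact: lebesgue_measure_set1.
Qed.

(** * Arrival times: strict growth and divergence *)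

Lemma partial_sumE (R : realType) (W : Type) (e : nat -> W -> R) j w :
  partial_sum e j w = series (e ^~ w) j.
Proof. by rewrite /partial_sum /series/= big_mkord. Qed.

Lemma partial_sum_le (R : realType) (W : Type) (e : nat -> W -> R) w :
  (forall i, 0 < e i w) ->
  {mono (partial_sum e)^~ w : m n / (m <= n)%N >-> m <= n}.
Proof.
move=> e0; apply/increasing_seqP => n.
by rewrite /partial_sum big_ord_recr/= ltrDl.
Qed.

(** A nondecreasing sequence that does not tend to $+\infty$ converges; the increments would then
    tend to 0, although infinitely many exceed 1. *)
Lemma partial_sum_cvgy (R : realType) (W : Type) (e : nat -> W -> R) w :
  (forall i, 0 < e i w) ->
  (forall m, exists2 i, (m <= i)%N & 1 < e i w) ->
  partial_sum e n w @[n --> \oo] --> +oo.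
Proof.
move=> e0 e1; have -> : (partial_sum e)^~ w = series (e ^~ w).
  by apply/funext => n; exact: partial_sumE.
apply: nondecreasing_dvgn_lt => [m n mn|/cvg_series_cvg_0].
  by rewrite -!partial_sumE partial_sum_le.
move=> /cvgrPdist_lt/(_ 1 ltr01)[m _ em].
have [i mi] := e1 m; have := em i mi; rewrite /= sub0r normrN gtr0_norm//.
by move=> /lt_trans/[apply]; rewrite ltxx.
Qed.

(** The complement splits into the open negative half-line, where the density vanishes, and $\{0\}$,
    which is Lebesgue null. *)
Lemma exponential_gt0_ae (R : realType) d (W : measurableType d)
    (P : probability W R) (r : R) (X : {RV P >-> R}) :
  (forall B : set R, measurable B -> distribution P X B = exponential_prob r B) ->
  {ae P, forall w, 0 < X w}.
Proof.
move=> Xr; have null (B : set R) : measurable B -> exponential_prob r B = 0%E ->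
    P.-negligible (X @^-1` B).
  move=> mB B0; apply/negligibleP; last by rewrite -B0 -Xr.
  by rewrite -[X in measurable X]setTI; exact: measurable_funPT.
have : P.-negligible (X @^-1` `]-oo, 0[ `|` X @^-1` [set 0]).
  apply: negligibleU; apply: null => //; last exact: integral_set1.
  apply: integral0_eq => x; rewrite /= in_itv/= => x0.
  by rewrite lt0_exponential_pdf.
apply: negligibleS => w /= /negP; rewrite -leNgt le_eqVlt in_itv/=.
by move=> /orP[/eqP|]; [right|left].
Qed.

(** Staying in [B] from index $m$ on implies staying there at $m,\ldots,m+k-1$, which by
    independence has probability $q^k$. Letting $k\to\infty$ gives a null event for each of the
    countably many $m$. *)
Lemma mutually_independent_often (R : realType) d (W : measurableType d)
    d' (T : measurableType d') (P : probability W R) (X : nat -> {RV P >-> T})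
    (B : set T) (q : R) :
  measurable B -> mutually_independent P X ->
  (forall i, P (X i @^-1` B) = q%:E) -> q < 1 ->
  {ae P, forall w m, exists2 i, (m <= i)%N & ~ B (X i w)}.
Proof.
move=> mB Xind XB q1.
have q0 : 0 <= q by rewrite -lee_fin -(XB 0%N) measure_ge0.
have mXB i : measurable (X i @^-1` B).
  by rewrite -[X in measurable X]setTI; exact: measurable_funPT.
apply: ae_foralln => m.
pose N := \bigcap_(i in [set i | (m <= i)%N]) (X i @^-1` B).
have mN : measurable N by apply: bigcap_measurableType.
have N0 : P N = 0%E.
  have PN k : (P N <= (q ^+ k)%:E)%E.
    pose J := seq_fset tt (iota m k).
    have <- : P (\bigcap_(i in [set` J]) (X i @^-1` B)) = (q ^+ k)%:E.
      rewrite (Xind J (fun=> B))//; under eq_bigr do rewrite XB.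
      rewrite prodEFin (perm_big _ (seq_fset_perm _ _)) undup_id ?iota_uniq//=.
      by rewrite -[k in iota _ k](addKn m) prodr_const_nat addKn.
    apply: le_measure; rewrite ?inE//.
      by apply: bigcap_measurableType.
    move=> w Nw i /= ; rewrite seq_fsetE mem_iota => /andP[mi _].
    exact: Nw.
  apply/eqP; rewrite eq_le measure_ge0 andbT.
  have q_cvg : (q ^+ k)%:E @[k --> \oo] --> 0%E.
    by apply: cvg_EFin; [exact: nearW|apply: cvg_expr; rewrite ger0_norm].
  rewrite -(cvg_lim _ q_cvg)//; apply: lime_ge.
    by apply/cvg_ex; eexists; exact: q_cvg.
  exact: nearW.
exists N; split=> // w /= Nw i mi; apply: contrapT => Bi; apply: Nw.
by exists i.
Qed.

(** The exponential law gives $[0,1]$ mass $1-e^{-1}<1$, so the sequence leaves $[0,1]$ infinitely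
    often; being positive, it can only leave above 1. *)
Lemma exponential_often_gt1 (R : realType) d (W : measurableType d)
    (P : probability W R) (e : nat -> {RV P >-> R}) :
  (forall j (B : set R), measurable B ->
    distribution P (e j) B = exponential_prob 1 B) ->
  mutually_independent P e ->
  {ae P, forall w m, exists2 i, (m <= i)%N & 1 < e i w}.
Proof.
move=> he eind.
have q1 : 1 - expR (- 1) < 1 :> R by rewrite ltrBlDr ltrDl expR_gt0.
have : {ae P, forall w m, exists2 i, (m <= i)%N & ~ `[0, 1]%classic (e i w)}.
  apply: (mutually_independent_often _ eind _ q1); first exact: measurable_itv.
  move=> i; have := he i `[0, 1]%classic (measurable_itv _).
  by rewrite exponential_prob_itv0c// mulr1.
have e0 : {ae P, forall w i, 0 < e i w}.
  by apply: ae_foralln => i; exact: exponential_gt0_ae (he i).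
apply: filterS2 e0 => w e0 ew m; have [i mi ei] := ew m; exists i => //.
rewrite ltNge; apply/negP => ei1; apply: ei.
by rewrite /= in_itv/= ei1 ltW.
Qed.

(** * Sampling at arrival times and telescoping the centerings *)

Lemma truncated_series_partial_sum (R : realType) (E : normedModType R)
    d (W : measurableType d) (P : probability W R) (S : Type)
    (b : R -> E) (H : R -> R -> S -> E) (e : nat -> W -> R)
    (V : nat -> W -> S) n t w :
  (forall i, 0 < e i w) ->
  truncated_series P b H (partial_sum e) V (partial_sum e n w) t w =
  b t + \sum_(j < n) H t (partial_sum e j.+1 w) (V j w)
  - compensator P H (V 0%N) (partial_sum e n w) t.
Proof.
move=> e0; rewrite /truncated_series.
rewrite (fsbig_ord _ _ (fun j => H t (partial_sum e j.+1 w) (V j w))).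
congr (_ + _ - _); congr (\big[_/_]_(_ \in _) _).
(* Strict growth turns $\Gamma_{j+1}\le\Gamma_n$ into $j<n$. *)
by apply/seteqP; split=> j /=; rewrite partial_sum_le.
Qed.

Lemma series_centering (R : realType) (E : normedModType R)
    d (W : measurableType d) (P : probability W R) (S : Type)
    (H : R -> R -> S -> E) (e : nat -> W -> R) (V : nat -> W -> S) n t w :
  \sum_(j < n) centering P H (partial_sum e) V j t w =
  compensator P H (V 0%N) (partial_sum e n w) t.
Proof.
rewrite -(big_mkord xpredT (fun j => centering P H (partial_sum e) V j t w)).
rewrite (telescope_sumr (fun j => compensator P H (V 0%N) (partial_sum e j w) t))//.
by rewrite [partial_sum e 0 w]big_ord0 compensator0 subr0.
Qed.

Theorem corollary3p2
  (R : realType) (E : completeNormedModType R) (hE : separable E)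
  (* the infinitely divisible process X *)
  (dX : measure_display) (WX : measurableType dX) (PX : probability WX R)
  (X : R -> WX -> E) (b : R -> E)
  (nu : forall n : nat, ('I_n -> R) ->
        {measure set (borel 'rV[E]_n) -> \bar R})
  (hX : process X)
  (hXid : infinitely_divisible_process PX X)
  (hXpath : forall w, cadlag (X ^~ w))
  (hnu : forall (n : nat) (t : 'I_n -> R), (forall j, t j \in `[0, 1]) ->
    levy_measure (nu n t))
  (hXfdd : forall (n : nat) (t : 'I_n -> R), (forall j, t j \in `[0, 1]) ->
    forall xs : 'I_n -> {linear E -> R^o}, (forall j, continuous (xs j)) ->
    cintegral PX (fun w => cexp (0 +i* \sum_(j < n) xs j (X (t j) w))) =
    cexp (0 +i* (\sum_(j < n) xs j (b (t j)))
          + cintegral (nu n t) (lk_integrand xs)))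
  (* the sequences Gamma and V *)
  (d : measure_display) (W : measurableType d) (P : probability W R)
  (dS : measure_display) (S : measurableType dS) (eta : probability S R)
  (V : nat -> {RV P >-> S})
  (hVlaw : forall j (B : set S), measurable B -> distribution P (V j) B = eta B)
  (hVind : mutually_independent P V)
  (e : nat -> {RV P >-> R})
  (helaw : forall j (B : set R), measurable B ->
    distribution P (e j) B = exponential_prob 1 B)
  (heind : mutually_independent P e)
  (Gamma : nat -> W -> R) (hGamma : Gamma = partial_sum e)
  (hGV : independent_sequences P Gamma V)
  (* the function H *)
  (H : R -> R -> S -> E)
  (hHmeas : measurable_fun
    ([set` `[0%R, 1%R]] `*` [set` `[0%R, +oo[] `*` setT : set (R * R * S))
    ((fun p : R * R * S => H p.1.1 p.1.2 p.2) : R * R * S -> borel E))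
  (hHnu : forall (n : nat) (t : 'I_n -> R), (forall j, t j \in `[0, 1]) ->
    forall B : set (borel 'rV[E]_n), measurable B ->
    (\int[lebesgue_measure]_(r in `[0%R, +oo[)
       P [set w | (B `\` [set (0 : 'rV[E]_n)%R]) (\row_j H (t j) r (V 0%N w))])%E
    = nu n t B)
  (hHpath : forall r v, 0 <= r -> cadlag (fun t => H t r v))
  (hHmono : forall v r1 r2, 0 <= r1 -> r1 <= r2 ->
    sup_norm (fun t => H t r2 v) <= sup_norm (fun t => H t r1 v))
  (* the process Y *)
  (Y : R -> W -> E)
  (hY : process Y)
  (hYpath : forall w, cadlag (Y ^~ w))
  (hYlim : {ae P, forall w,
    {uniform `[0, 1],
      (fun u t => truncated_series P b H Gamma V u t w) @ +oo --> Y ^~ w}}) :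
  {ae P, forall w,
    let f := fun j t =>
      H t (Gamma j.+1 w) (V j w) - centering P H Gamma V j t w in
    uniformly_convergent_series f /\
    forall t, t \in `[0, 1] -> Y t w = b t + series_sum f t} /\
  ({within `[0, 1], continuous b} ->
   (\forall u \near +oo,
      {within `[0, 1], continuous (compensator P H (V 0%N) u)}) ->
   {ae P, forall w,
     let f := fun j t => jump (fun s => H s (Gamma j.+1 w) (V j w)) t in
     uniformly_convergent_series f /\
     forall t, t \in `[0, 1] -> jump (Y ^~ w) t = series_sum f t}).
Proof.
(* All almost sure facts are collected here; both claims are then proved outcome by outcome. *)
have {hYlim} hae : {ae P, forall w, [/\ forall i, 0 < e i w,
    Gamma n w @[n --> \oo] --> +oo &
    {uniform `[0, 1], (fun n t =>
      b t + \sum_(j < n) H t (Gamma j.+1 w) (V j w)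
      - compensator P H (V 0%N) (Gamma n w) t) @ \oo --> Y ^~ w}]}.
  have he0 : {ae P, forall w i, 0 < e i w}.
    by apply: ae_foralln => i; exact: exponential_gt0_ae (helaw i).
  have := exponential_often_gt1 helaw heind.
  apply: filterS3 he0 hYlim => w ew Yw e1w.
  have Gw : Gamma n w @[n --> \oo] --> +oo.
    by rewrite hGamma; exact: partial_sum_cvgy.
  split=> //; apply/uniform_cvgP => eps eps0.
  move/uniform_cvgP : Yw => /(_ eps eps0) Yw.
  (* Divergence of $\Gamma_n$ pulls a bound valid for large $u$ back to one valid for large $n$. *)
  have [N _ NY] := Gw _ Yw; exists N => // n /NY Yn t /Yn.
  by rewrite hGamma truncated_series_partial_sum.
split.
  apply: filterS hae => w [ew Gw Yw].
  set f := (X in uniformly_convergent_series X).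
  have bfE n t : b t + series (f ^~ t) n = b t +
      \sum_(j < n) H t (Gamma j.+1 w) (V j w)
      - compensator P H (V 0%N) (Gamma n w) t.
    rewrite hGamma -(series_centering _ _ _ (fun j => V j)) -addrA -sumrB /f hGamma.
    by rewrite /series/= big_mkord.
  (* By [bfE], the partial sums of [f] converge uniformly to $Y-b$. *)
  have [|cf Yf] := @uniformly_convergent_seriesP _ _ f (fun t => Y t w - b t).
    apply/uniform_cvgP => eps eps0; move/uniform_cvgP : Yw => /(_ eps eps0).
    apply: filterS => n Yn t /Yn.
    by rewrite -bfE opprD addrA.
  by split=> // t t01; rewrite -Yf// addrC subrK.
move=> b_cont A_cont; apply: filterS hae => w [ew Gw Yw].
set f := (X in uniformly_convergent_series X).
have H_left j t : t \in `[0, 1] -> 0 < t ->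
    cvg (H s (Gamma j.+1 w) (V j w) @[s --> t^'-]).
  rewrite in_itv/= => /andP[_ t1] t0.
  have [|_] := hHpath (Gamma j.+1 w) (V j w); last by apply; rewrite t0.
  (* The paths of [H] are càdlàg for $r\ge0$, and $\Gamma_{j+1}$ is a sum of positive terms. *)
  by rewrite hGamma sumr_ge0// => i _; exact: ltW.
pose Yn n t := b t + \sum_(j < n) H t (Gamma j.+1 w) (V j w)
      - compensator P H (V 0%N) (Gamma n w) t.
(* This [N] depends on the outcome: from it on, $\Gamma_n$ lies in the range of $u$ where $A^u$ is
   continuous. *)
have [N _ NA] := Gw _ A_cont.
have Yn_left n t : (N <= n)%N -> t \in `[0, 1] -> 0 < t ->
    Yn n s @[s --> t^'-] --> b t +
      \sum_(j < n) lim (H s (Gamma j.+1 w) (V j w) @[s --> t^'-])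
      - compensator P H (V 0%N) (Gamma n w) t.
  move=> Nn t01 t0; have t01' : 0 < t <= 1.
    by move: t01; rewrite in_itv/= t0 => /andP[].
  have An := NA n Nn; apply: cvgB; last exact: within_continuous_left.
  apply: cvgD; first exact: within_continuous_left.
  by apply: cvg_big => [|j _]; [exact: add_continuous|exact: H_left].
have jumpYn n t : (N <= n)%N -> t \in `[0, 1] ->
    jump (Yn n) t = series (f ^~ t) n.
  move=> Nn t01; rewrite /series/= big_mkord; have [t0|t0] := ltP 0 t; last first.
    (* At $t=0$ every jump is 0 by convention. *)
    by rewrite /f /jump ltNge t0/= big1.
  (* The function [b] and the compensator equal their left limits and cancel, leaving the jumps of
     [H] term by term. *)
  rewrite (jump_cvg t0 (Yn_left _ _ Nn t01 t0)) /Yn /f.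
  rewrite [RHS](eq_bigr (fun j : 'I_n => H t (Gamma j.+1 w) (V j w) -
      lim (H s (Gamma j.+1 w) (V j w) @[s --> t^'-]))); last first.
    by move=> j _; rewrite (jump_cvg t0 (H_left j t t01 t0)).
  by rewrite sumrB opprB addrA subrK opprD addrACA subrr add0r.
apply: uniformly_convergent_seriesP.
apply/uniform_cvgP => eps eps0.
(* The jump doubles a uniform bound, so $\varepsilon/4$ becomes $\varepsilon/2$, which is strictly
   below $\varepsilon$. *)
have eps40 : 0 < eps / 2 / 2 by rewrite !divr_gt0.
move/uniform_cvgP : Yw => /(_ _ eps40) Yw.
near=> n => t t01.
have Nn : (N <= n)%N by near: n; exact: nbhs_infty_ge.
have Y_left : 0 < t -> cvg (Y s w @[s --> t^'-]).
  by move=> t0; apply: (hYpath w).2; move: t01; rewrite /= in_itv/= t0 => /andP[].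
have Yn_cvg : 0 < t -> cvg (Yn n s @[s --> t^'-]).
  by move=> t0; apply/cvg_ex; eexists; exact: Yn_left.
rewrite -jumpYn// -jumpB//.
apply: (@le_lt_trans _ _ (eps / 2 / 2 + eps / 2 / 2)).
  apply: jump_le => //; [exact: ltW| |].
    by move=> t0; apply: is_cvgB; [exact: Y_left|exact: Yn_cvg].
  move=> s s01; apply/ltW; move: s s01; near: n; exact: Yw.
by rewrite -splitr ltr_pdivrMr// ltr_pMr// ltr1n.
Unshelve. all: by end_near. Qed.
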